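(* Let $S$ be a numerical semigroup with minimal generators $a_1<a_2<\dots<a_t$, and let $U$ be the set of maximally reduced elements of $S$. Then: (1) $U$ is a finite set; (2) $\mathrm{d}_{\max}(S)=\max_{s\in U}\mathrm{d}_{\max}(s;S)$, that is, $\max_{s\in S}\mathrm{d}_{\max}(s;S)=\max_{s\in U}\mathrm{d}_{\max}(s;S)$. Thus $\mathrm{d}_{\max}(S)$ is finite.
   Context: $\mathbb{N}$ denotes the nonnegative integers. A numerical semigroup $S$ is a subset of $\mathbb{N}$ closed under addition, containing $0$, with finite complement in $\mathbb{N}$. It has a unique minimal generating set $\{a_1<\dots<a_t\}$: the minimal elements of $S\setminus\{0\}$ for the partial order $u\preceq u'$ iff $u'-u\in S$. A factorization of $s\in S$ is a tuple $(c_1,\dots,c_t)\in\mathbb{N}^t$ with $s=c_1a_1+\dots+c_ta_t$; its length is $c_1+\dots+c_t$. Each $s$ has finitely many factorizations. A factorization of $s$ is maximal if its length is the largest among all factorizations of $s$. $\mathrm{d}_{\max}(s;S)$ is the number of maximal factorizations of $s$, and $\mathrm{d}_{\max}(S)=\max_{s\in S}\mathrm{d}_{\max}(s;S)$ (a priori a supremum, possibly infinite). An element $u\in S$ is called maximally reduced if for each $i$ with $1\le i\le t$ there exists a maximal factorization $(c_1,\dots,c_t)$ of $u$ with $c_i=0$ (the factorization may depend on $i$). *)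

(* Defs.v *)
From mathcomp Require Import all_boot all_order finmap.
From mathcomp Require Import all_classical.

Set Implicit Arguments.
Unset Strict Implicit.
Unset Printing Implicit Defensive.

Local Open Scope classical_set_scope.
Local Open Scope nat_scope.

Definition numerical_semigroup (S : set nat) : Prop :=
  [/\ S 0, (forall x y, S x -> S y -> S (x + y)) & finite_set (~` S)].

(* The guard [u <= v] is needed because subtraction on [nat] is truncated. *)
Definition sg_le (S : set nat) (u v : nat) : Prop := u <= v /\ S (v - u).

Definition minimal_generators (S : set nat) : set nat :=
  [set u | [/\ S u, u <> 0 &
    forall v, S v -> v <> 0 -> sg_le S v u -> v = u]].

Section Factorizations.
Variables (t : nat) (a : t.-tuple nat).

Definition factorization (s : nat) : set (t.-tuple nat) :=
  [set c | s = \sum_(i < t) tnth c i * tnth a i].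

Definition fact_length (c : t.-tuple nat) : nat := \sum_(i < t) tnth c i.

Definition max_factorization (s : nat) : set (t.-tuple nat) :=
  [set c | factorization s c /\
    forall c', factorization s c' -> fact_length c' <= fact_length c].

(* [fset_set] is the empty set on infinite arguments; this case does not arise
   for positive generators, see [finite_max_factorization]. *)
Definition dmax (s : nat) : nat := #|` fset_set (max_factorization s)|.

Definition maximally_reduced (S : set nat) : set nat :=
  [set u | S u /\
    forall i : 'I_t, exists2 c, max_factorization u c & tnth c i = 0].

End Factorizations.

(* Supremum of a set of naturals, with [None] standing for infinity. *)
Definition nat_sup (A : set nat) : option nat :=
  if `[< has_ubound A >] then Some (supremum 0 A) else None.

Definition dmax_semigroup (S : set nat) (t : nat) (a : t.-tuple nat) :
    option nat :=
  nat_sup (dmax a @` S).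

Definition is_maximum (A : set nat) (m : nat) : Prop :=
  A m /\ forall x, A x -> x <= m.

Lemma finite_factorization (t : nat) (a : t.-tuple nat) (s : nat) :
  (forall i, 0 < tnth a i) -> finite_set (factorization a s).
Proof.
move=> a_gt0.
pose f (g : {ffun 'I_t -> 'I_s.+1}) := [tuple nat_of_ord (g i) | i < t].
apply: (@sub_finite_set _ _ (f @` setT)); last first.
  by apply: finite_image; exact: finite_finset.
move=> c /= cs; exists [ffun i => inord (tnth c i)] => //.
apply: eq_from_tnth => i; rewrite tnth_mktuple ffunE inordK // ltnS.
by rewrite cs (bigD1 i) //= (leq_trans (leq_pmulr _ (a_gt0 i))) // leq_addr.
Qed.

Lemma finite_max_factorization (S : set nat) (t : nat) (a : t.-tuple nat) s :
  [set` a] = minimal_generators S -> finite_set (max_factorization a s).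
Proof.
move=> aS; apply: (@sub_finite_set _ _ (factorization a s)) => [c []//|].
apply: finite_factorization => i.
have : [set` a] (tnth a i) by rewrite /= mem_tnth.
by rewrite aS => -[_ /eqP]; rewrite lt0n.
Qed.

(* Every numerical semigroup has an increasing finite tuple of minimal
   generators. *)
Lemma minimal_generators_tuple (S : set nat) : numerical_semigroup S ->
  exists (t : nat) (a : t.-tuple nat),
    sorted ltn a /\ [set` a] = minimal_generators S.
Proof.
move=> [S0 SD cofS].
have [m [Sm m_gt0]] : exists m, S m /\ 0 < m.
  apply: contrapT => nS; apply: infinite_nat.
  apply: (@sub_finite_set _ _ (0 |` ~` S)).
    move=> [|n] _; [by left|right => Sn].
    by apply: nS; exists n.+1.
  by rewrite finite_setU; split => //; exact: finite_set1.
have SM k : S (k * m) by elim: k => // k IH; rewrite mulSn; apply: SD.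
have fG : finite_set (minimal_generators S).
  have fI : finite_set ((fun u => u %% m) @` minimal_generators S).
    apply: (@sub_finite_set _ _ `I_m) => [_ [u _ <-]|]; last exact: finite_II.
    by rewrite /= ltn_mod.
  have inj : {in minimal_generators S &, injective (fun u => u %% m)}.
    suff H u v : minimal_generators S u -> minimal_generators S v ->
        u <= v -> u %% m = v %% m -> u = v.
      move=> u v /set_mem Gu /set_mem Gv e.
      by case: (leqP u v) => [|/ltnW] uv; [|symmetry]; apply: H.
    move=> [Su u0 _] [Sv v0 minv] uv e; apply: minv => //; split=> //.
    have /dvdnP[k ->] : m %| v - u by rewrite -eqn_mod_dvd // e.
    exact: SM.
  by move: fI; rewrite (eq_finite_set (inj_card_eq inj)).
have [s eS] := (finite_seqP _).1 fG.
exists _, (in_tuple (sort leq (undup s))); split => /=.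
  by rewrite ltn_sorted_uniq_leq sort_uniq undup_uniq (sort_sorted leq_total).
by rewrite eS; apply/seteqP; split=> x /=; rewrite mem_sort mem_undup.
Qed.

(* Main.v *)
(** Exchanging [a_1] copies of a generator [a_j > a_1] for [a_j] copies of
    [a_1] strictly increases the length. Hence a maximal factorization that
    avoids [a_1] uses every generator fewer than [a_1] times, which bounds the
    maximally reduced elements. If [s] is not maximally reduced, some [a_i] is
    used by all its maximal factorizations; deleting one copy of it embeds them
    into the maximal factorizations of [s - a_i]. Descending in this way, every
    value of [dmax] is dominated by a value on a maximally reduced element. *)
Require Import Defs.
From mathcomp Require Import all_boot all_order finmap.
From mathcomp Require Import all_classical.

Set Implicit Arguments.
Unset Strict Implicit.

Local Open Scope classical_set_scope.
Local Open Scope nat_scope.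

(** * Exchanging copies of generators in a factorization *)

Section Exchange.
Variables (t : nat) (a : t.-tuple nat).
Implicit Types (c : t.-tuple nat) (i j : 'I_t).

(** Gains [m] copies at [i] and loses [n] at [j]. The gain comes first, so [i = j] is allowed:
    [exchange c i 0 i 1] deletes one copy of generator [i], and [exchange c i 1 i 0] adds one.
    Meaningful only for [n <= tnth c j], as subtraction truncates. *)
Definition exchange c i m j n : t.-tuple nat :=
  [tuple tnth c k + (k == i) * m - (k == j) * n | k < t].

Lemma sum_delta (F : 'I_t -> nat) i m :
  \sum_(k < t) (k == i) * m * F k = m * F i.
Proof.
by rewrite (bigD1 i) //= eqxx mul1n big1 ?addn0 // => k /negPf->.
Qed.

(** The weight [F] covers two uses at once: constant 1 gives the length, [tnth a] the element being
    factored. *)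
Lemma sum_exchange (F : 'I_t -> nat) c i m j n : n <= tnth c j ->
  \sum_(k < t) tnth (exchange c i m j n) k * F k + n * F j =
  \sum_(k < t) tnth c k * F k + m * F i.
Proof.
move=> le_n_cj; rewrite -(sum_delta F i) -(sum_delta F j) -!big_split /=.
apply: eq_bigr => k _; rewrite tnth_mktuple -!mulnDl subnK //.
by case: eqP => [->|_]; rewrite ?mul0n // mul1n (leq_trans le_n_cj) ?leq_addr.
Qed.

Lemma fact_length_exchange c i m j n : n <= tnth c j ->
  fact_length (exchange c i m j n) + n = fact_length c + m.
Proof.
move=> /(sum_exchange (fun=> 1) i m); rewrite !muln1.
by under eq_bigr do rewrite muln1; under [in RHS]eq_bigr do rewrite muln1.
Qed.

Lemma factorization_exchange s s' c i m j n : n <= tnth c j ->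
  s' + n * tnth a j = s + m * tnth a i ->
  factorization a s c -> factorization a s' (exchange c i m j n).
Proof.
move=> le_n_cj e cs; apply: (@addIn (n * tnth a j)).
by rewrite sum_exchange // e {1}cs.
Qed.

Lemma max_factorization_lt s c i j : max_factorization a s c ->
  tnth a i < tnth a j -> tnth c j < tnth a i.
Proof.
move=> [cs cmax] lt_ij; rewrite ltnNge; apply/negP => le_cj.
have /cmax : factorization a s (exchange c i (tnth a j) j (tnth a i)).
  by apply: (factorization_exchange (s := s)) => //; rewrite mulnC.
rewrite leqNgt => /negP; apply.
by rewrite -(ltn_add2r (tnth a i)) fact_length_exchange // ltn_add2l.
Qed.

Lemma max_factorization_delete s c i : max_factorization a s c ->
  0 < tnth c i -> max_factorization a (s - tnth a i) (exchange c i 0 i 1).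
Proof.
move=> [cs cmax] ci_gt0.
have le_as : tnth a i <= s.
  by rewrite cs (bigD1 i) //= (leq_trans (leq_pmull _ ci_gt0)) ?leq_addr.
split=> [|c' c's].
  by apply: (factorization_exchange (s := s)) => //; rewrite mul1n subnK ?addn0.
(* A longer factorization [c'] of [s - tnth a i] would, after adding one copy of generator [i], be a
   factorization of [s] longer than [c]. *)
rewrite -(leq_add2r 1) fact_length_exchange // addn0.
rewrite -(fact_length_exchange i 1 (leq0n (tnth c' i))) addn0; apply: cmax.
apply: (factorization_exchange (s := s - tnth a i)) => //.
by rewrite mul1n subnK ?addn0.
Qed.

(** Positivity matters: truncated subtraction sends both 0 and 1 to 0. *)
Lemma exchange_delete_inj c c' i : 0 < tnth c i -> 0 < tnth c' i ->
  exchange c i 0 i 1 = exchange c' i 0 i 1 -> c = c'.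
Proof.
move=> ci c'i e; apply: eq_from_tnth => k.
have := congr1 (fun d => tnth d k) e; rewrite !tnth_mktuple !muln0 !addn0.
case: eqP => [->|_]; rewrite ?subn0 // !mul1n !subn1 => e'.
by rewrite -(prednK ci) e' prednK.
Qed.

End Exchange.

(** * Generators and finiteness of the set of maximally reduced elements *)

Section NumericalSemigroup.
Variables (S : set nat) (hS : numerical_semigroup S).
Variables (t : nat) (a : t.-tuple nat).
Hypothesis a_gens : [set` a] = minimal_generators S.

Lemma tnth_generator i : S (tnth a i) /\ 0 < tnth a i.
Proof.
have : [set` a] (tnth a i) by rewrite /= mem_tnth.
by rewrite a_gens => -[Sa /eqP]; rewrite lt0n.
Qed.

Lemma factorization_in s c : factorization a s c -> S s.
Proof.
case: hS => S0 SD _ ->; elim/big_ind: _ => // i _.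
elim: (tnth c i) => // k IH; rewrite mulSn; apply: SD => //.
by have [] := tnth_generator i.
Qed.

Lemma minimal_generators_nonempty : exists u, minimal_generators S u.
Proof.
have [S0 SD cofS] := hS.
have exS : exists m, (0 < m) && `[< S m >].
  apply: contrapT => nS; apply: infinite_nat.
  apply: (@sub_finite_set _ _ (0 |` ~` S)).
    move=> [|n] _; [by left | right => Sn].
    by apply: nS; exists n.+1; apply/asboolP.
  by rewrite finite_setU; split.
(* The least positive element of [S] is minimal for [sg_le], since [sg_le] implies [<=]. *)
case: (ex_minnP exS) => m /andP[m_gt0 /asboolP Sm] min_m.
exists m; split=> // [m0 | v Sv v_neq0 [le_vm _]]; first by rewrite m0 in m_gt0.
apply/eqP; rewrite eqn_leq le_vm min_m // lt0n; apply/andP; split.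
  exact/eqP.
exact/asboolP.
Qed.

Lemma num_generators_gt0 : 0 < t.
Proof.
have [u] := minimal_generators_nonempty; rewrite -a_gens /= => /tnthP[i _].
exact: leq_trans (ltn_ord i).
Qed.

Lemma maximally_reduced0 : maximally_reduced a S 0.
Proof.
have [S0 _ _] := hS; split=> // i; exists [tuple 0 | _ < t]; last first.
  by rewrite tnth_mktuple.
split=> [|c c0].
  by rewrite /factorization /= big1 // => k _; rewrite tnth_mktuple.
rewrite [fact_length c]big1 // => k _; apply/eqP; move: c0 => /esym/eqP.
rewrite sum_nat_eq0 => /forallP/(_ k) /=; rewrite muln_eq0 => /orP[//|].
by have [_] := tnth_generator k; rewrite lt0n => /negPf->.
Qed.

Lemma finite_maximally_reduced :
  sorted ltn a -> finite_set (maximally_reduced a S).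
Proof.
move=> a_sorted; pose i0 := Ordinal num_generators_gt0.
(* [i0] indexes the smallest generator. A maximal factorization vanishing at [i0] has every
   coefficient at most [tnth a i0], hence the bound. *)
apply: (@sub_finite_set _ _ `I_(\sum_(j < t) tnth a i0 * tnth a j).+1).
  move=> u [Su /(_ i0)[c cmax c0]]; rewrite /= ltnS.
  have [-> _] := cmax; apply: leq_sum => j _; apply: leq_mul => //.
  have [j0|j_gt0] := posnP j.
    by rewrite (_ : j = i0) ?c0 //; exact: val_inj.
  apply/ltnW/(max_factorization_lt cmax).
  rewrite !(tnth_nth 0).
  by apply: (sorted_ltn_nth ltn_trans) => //; rewrite inE size_tuple.
exact: finite_II.
Qed.

(** * Descent to maximally reduced elements *)

Lemma dmax_delete s i :
  (forall c, max_factorization a s c -> 0 < tnth c i) ->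
  dmax a s <= dmax a (s - tnth a i).
Proof.
move=> c_gt0; pose f c := exchange c i 0 i 1.
(* Finiteness rules out the default value of [fset_set], so that membership in it is genuine. *)
have fin s' := finite_max_factorization s' a_gens.
have inj_f : {in fset_set (max_factorization a s) &, injective f}.
  move=> c c'; rewrite !in_fset_set // !inE => cmax c'max.
  by apply: exchange_delete_inj; exact: c_gt0.
rewrite /dmax -[leqLHS](card_in_imfset imfset_key inj_f) /=.
apply: fsubset_leq_card; apply/fsubsetP => _ /imfsetP[c /= + ->].
rewrite !in_fset_set // !inE => cmax.
by apply: max_factorization_delete => //; exact: c_gt0.
Qed.

Lemma dmax_le_maximally_reduced s : S s ->
  exists2 u, maximally_reduced a S u & dmax a s <= dmax a u.
Proof.
elim/ltn_ind: s => s IH Ss.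
have [|nred] := EM (maximally_reduced a S s); first by exists s.
have [i c_gt0] : exists i, forall c, max_factorization a s c -> 0 < tnth c i.
  apply: contrapT => nex; apply: nred; split=> // i.
  apply: contrapT => nc; apply: nex; exists i => c cmax.
  by rewrite lt0n; apply/eqP => c0; apply: nc; exists c.
(* Without a maximal factorization [dmax a s] is 0, and the maximally reduced element 0 dominates
   it. *)
have [[c cmax]|nomax] := EM (exists c, max_factorization a s c); last first.
  exists 0; first exact: maximally_reduced0.
  rewrite /dmax (_ : max_factorization a s = set0) ?fset_set0 ?cardfs0 //.
  by apply/seteqP; split=> // c cmax; apply: nomax; exists c.
have [_ a_gt0] := tnth_generator i.
(* The shortened factorization shows that [s - tnth a i] is still in [S], so the induction
   hypothesis applies to it. *)
have [c's _] := max_factorization_delete cmax (c_gt0 c cmax).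
have s_gt0 : 0 < s.
  have [-> _] := cmax.
  by rewrite (bigD1 i) //= ltn_addr // muln_gt0 c_gt0.
have [|u Uu le_u] := IH (s - tnth a i) _ (factorization_in c's).
  by rewrite ltn_subrL a_gt0.
by exists u => //; exact: leq_trans (dmax_delete c_gt0) le_u.
Qed.

End NumericalSemigroup.

(** * Maxima, suprema and the conclusion *)

Lemma finite_nat_maximum (A : set nat) :
  finite_set A -> A !=set0 -> exists m, is_maximum A m.
Proof.
move=> /finite_seqP[s ->] [x xs].
have [|m ms le_m] :=
    @ex_maxnP (fun y => y \in s) (\max_(y <- s) y) (ex_intro _ x xs).
  by move=> y ys; exact: leq_bigmax_seq.
by exists m.
Qed.

Lemma nat_sup_maximum (A : set nat) m : is_maximum A m -> nat_sup A = Some m.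
Proof.
move=> [Am le_m]; rewrite /nat_sup asboolT; last by exists m => y /le_m.
have supAm : supremums A m.
  by split=> [x /le_m | x]; [rewrite Order.NatOrder.leEnat | exact].
rewrite /supremum ifF; last by apply/negbTE/set0P; exists m.
by rewrite (is_subset1_supremums (xgetPex 0 (ex_intro _ m supAm)) supAm).
Qed.

Theorem theorem2p3 (S : set nat) (hS : numerical_semigroup S)
    (t : nat) (a : t.-tuple nat) (a_sorted : sorted ltn a)
    (a_gens : [set` a] = minimal_generators S) :
  finite_set (maximally_reduced a S) /\
  exists m : nat,
    [/\ dmax_semigroup S a = Some m,
        is_maximum [set dmax a s | s in S] m &
        is_maximum [set dmax a s | s in maximally_reduced a S] m].
Proof.
have finU := finite_maximally_reduced hS a_gens a_sorted.
split=> //.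
have [||m maxU] :=
    @finite_nat_maximum [set dmax a s | s in maximally_reduced a S].
- exact: finite_image.
- by exists (dmax a 0), 0 => //; exact: (maximally_reduced0 hS a_gens).
(* The value [m] is attained in [S] because maximally reduced elements lie in [S]; the descent shows
   that it bounds every [dmax a s]. *)
have maxS : is_maximum [set dmax a s | s in S] m.
  have [[u [Su _] <-] le_m] := maxU; split=> [|_ [s Ss <-]]; first by exists u.
  have [v Uv /leq_trans] := dmax_le_maximally_reduced hS a_gens Ss.
  by apply; apply: le_m; exists v.
by exists m; split=> //; exact: nat_sup_maximum.
Qed.
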